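(* Let $E$ be a real Banach space and $F$ a Banach lattice. Let $I$ be a non-empty set and let $(T_i)_{i \in I}$ be a family of bounded linear operators from $E$ to $F$. Assume that for each $x \in E$ the orbit $\{T_i x : i \in I\}$ is order bounded in $F$. Then there exists a real number $M \ge 0$ with the following property: for each $x \in E$ there exists a vector $y \in F_+$ of norm $\|y\| \le M\|x\|$ such that the orbit $\{T_i x : i \in I\}$ is contained in the order interval $[-y,y]$.
   Context: Banach lattices are real; $F_+$ denotes the positive cone of $F$, and $[-y,y] = \{z \in F : -y \le z \le y\}$. A subset of $F$ is order bounded if it is contained in some order interval $[a,b] = \{z \in F : a \le z \le b\}$. *)

(* Defs.v *)
From HB Require Import structures.
From mathcomp Require Import all_boot all_order all_algebra.
From mathcomp Require Import all_classical all_reals all_analysis.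

Set Implicit Arguments.
Unset Strict Implicit.
Unset Printing Implicit Defensive.

Import Order.TTheory GRing.Theory Num.Theory.
Import numFieldNormedType.Exports.
Local Open Scope classical_set_scope.
Local Open Scope ring_scope.

(* The order data are explicit fields because Hierarchy Builder rejects a new
   join of Order.Lattice with an additive structure: Num.RealDomain already
   inherits from both. The library's lattice structure is recovered below, so
   that <= on a Banach lattice is vle, and Order.join is vjoin.
   In vle_norm, vjoin u (- u) is the lattice modulus |u|, whereas `|u| is the
   norm of u. *)
HB.mixin Record isBanachLattice (R : realType) F
    of CompleteNormedModule R F := {
  vle : rel F ;
  vmeet : F -> F -> F ;
  vjoin : F -> F -> F ;
  vle_refl : reflexive vle ;
  vle_anti : antisymmetric vle ;
  vle_trans : transitive vle ;
  vle_meet : forall u v w, vle u (vmeet v w) = vle u v && vle u w ;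
  vjoin_le : forall u v w, vle (vjoin u v) w = vle u w && vle v w ;
  vle_add2r : forall w u v, vle u v -> vle (u + w) (v + w) ;
  vscale_ge0 : forall (a : R) u, 0 <= a -> vle 0 u -> vle 0 (a *: u) ;
  vle_norm : forall u v,
    vle (vjoin u (- u)) (vjoin v (- v)) -> `|u| <= `|v|
}.

#[short(type="banachLatticeType")]
HB.structure Definition BanachLattice (R : realType) :=
  {F of isBanachLattice R F & CompleteNormedModule R F}.

Section order.
Variables (R : realType) (F : banachLatticeType R).
HB.instance Definition _ := Order.Le_isPOrder.Build ring_display (F : Type)
  (@vle_refl R F) (@vle_anti R F) (@vle_trans R F).
HB.instance Definition _ := Order.POrder_isMeetSemilattice.Build ring_display
  (F : Type) (@vle_meet R F).
HB.instance Definition _ := Order.POrder_isJoinSemilattice.Build ring_display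
  (F : Type) (@vjoin_le R F).
End order.

Definition order_bounded (R : realType) (F : banachLatticeType R)
    (A : set F) : Prop :=
  exists a b : F, A `<=` `[a, b].

(* Main.v *)
(* The pairs (x, y) with 0 <= y and T_i x in [-y, y] for all i form a closed
   convex cone C in E x F, symmetric in x, and order boundedness of the orbits
   says that C projects onto E. By Baire, some set
   {x | C (x, y) for some y with |y| <= n} is dense in a ball; by symmetry and
   convexity it is dense in a ball centered at 0. Hence every z is approximated
   within |z|/2 by some a with C (a, b) and |b| <= K |z|. Iterating on the
   remainders and summing the series of the b's yields, since C is closed, some
   y with C (x, y) and |y| <= 2 K |x|. *)
Require Import Defs.
From mathcomp Require Import all_boot all_order all_algebra.
From mathcomp Require Import all_classical all_reals all_analysis.
From mathcomp Require Import ring.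
Import Order.TTheory GRing.Theory Num.Theory.
Import numFieldNormedType.Exports.
Local Open Scope classical_set_scope.
Local Open Scope ring_scope.

Section BanachLatticeOrder.
Context {R : realType} {F : banachLatticeType R}.
Implicit Types (u v w : F) (a : R).

Lemma vlerD u v u' v' : u <= v -> u' <= v' -> u + u' <= v + v'.
Proof.
move=> uv uv'; apply: (le_trans (vle_add2r u' _ _ uv)).
by rewrite ![v + _]addrC; exact: vle_add2r.
Qed.

Lemma vsubr_ge0 u v : (0 <= v - u) = (u <= v).
Proof.
apply/idP/idP => [/(vle_add2r u)|/(vle_add2r (- u))].
- by rewrite add0r subrK.
- by rewrite subrr.
Qed.

Lemma vlerZ a u v : 0 <= a -> u <= v -> a *: u <= a *: v.
Proof.
move=> a0 uv; rewrite -vsubr_ge0 -scalerBr; apply: vscale_ge0 => //.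
by rewrite -[vle _ _]/(0 <= v - u) vsubr_ge0.
Qed.

Lemma vge0_le_modulus u : 0 <= Order.join u (- u).
Proof.
set m := Order.join u (- u).
(* Adding [u <= m] and [- u <= m] gives [0 <= m + m]; it remains to halve. *)
have /(vlerZ 2^-1) : 0 <= m + m.
  by rewrite -(subrr u); apply: vlerD; rewrite ?leUl ?leUr.
rewrite scaler0 -[m + m]/(m *+ 2) -(scaler_nat 2 (m : F)) scalerA.
by rewrite mulVf ?pnatr_eq0// scale1r; apply; rewrite invr_ge0.
Qed.

(** Since [- u <= 0 <= u], the vector [u] is its own modulus, and [vle_norm] applies. *)
Lemma vler_norm u v : 0 <= u -> u <= Order.join v (- v) -> `|u| <= `|v|.
Proof.
move=> u0 uv; apply: vle_norm; suff -> : vjoin u (- u) = u by [].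
apply/join_idPl/(le_trans _ u0).
by rewrite -vsubr_ge0 opprK add0r.
Qed.

(* The negative part of [v] is dominated by the modulus of [u - v] for every
   [u >= 0], so its norm is at most the distance from [v] to the cone. *)
Lemma closed_vge0 : closed [set v : F | 0 <= v].
Proof.
move=> v clv; rewrite /=; pose n := Order.join (- v) 0.
suff n0 : n = 0.
  have : - v <= 0 by rewrite -n0 leUl.
  by rewrite -vsubr_ge0 opprK add0r.
have nP u : 0 <= u -> `|n| <= `|u - v|.
  move=> u0; apply: vler_norm; first exact: leUr.
  rewrite leUx vge0_le_modulus andbT; apply: le_trans (leUl _ _).
  by rewrite -{1}(add0r (- v)); exact: vlerD.
apply/normr0_eq0/eqP; rewrite eq_le normr_ge0 andbT.
apply/ler_addgt0Pr => e e0; rewrite add0r.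
have [u [/= u0]] := clv _ (nbhsx_ballx v e e0).
by rewrite -ball_normE /= distrC => /ltW; exact/le_trans/nP.
Qed.

End BanachLatticeOrder.

Section ClosedConvexProcess.
Context {R : realType} {E F : completeNormedModType R}.
(** [C] is the graph of a set-valued map from [E] to [F], a closed convex process; only the norm of
    [F] enters here, not its order. *)
Variable C : set (E * F).
Hypothesis C_add : forall p q, C p -> C q -> C (p + q).
Hypothesis C_scale : forall (a : R) p, 0 <= a -> C p -> C (a *: p).
Hypothesis C_opp : forall x y, C (x, y) -> C (- x, y).
Hypothesis C_closed : closed C.
Hypothesis C_total : forall x, exists y, C (x, y).

Let domain_below (r : R) : set E :=
  [set x | exists2 y, C (x, y) & `|y| <= r].

Let C_0 : C 0.
Proof. by have [y /(C_scale 0 _ (lexx 0))] := C_total 0; rewrite scale0r. Qed.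

Lemma process_somewhere_dense :
  exists (n : nat) x (r : {posnum R}),
    ball x r%:num `<=` closure (domain_below n%:R).
Proof.
(* Each [x] lies in [domain_below n] once [n] exceeds the norm of some [y] with [C (x, y)]. Hence
   the open sets [O n] have empty intersection, and by Baire they cannot all be dense. *)
pose O n := ~` closure (domain_below n%:R).
have O_open n : open (O n) by exact/closed_openC/closed_closure.
have : ~ dense (\bigcap_n O n).
  rewrite (_ : \bigcap_n _ = set0) ?dense0//.
    by move=> /(_ setT (ex_intro _ 0 I) openT) [x []].
  rewrite -subset0 => x /(_ (Num.truncn (`|projT1 (cid (C_total x))|)).+1 I).
  apply; apply: subset_closure; case: cid => y /= Cxy.
  by exists y => //; exact/ltW/truncnS_gt.
move=> ndense; have [n] : exists n, ~ dense (O n).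
  apply: contrapT => /forallNP dO; apply: ndense.
  by apply: Baire => n; split=> //; exact: contrapT (dO n).
move=> /denseNE[U [[x [oU Ux]] UO]].
have /nbhs_ballP[r r0 xrU] : nbhs x U by exact: open_nbhs_nbhs.
exists n, x, (PosNum r0) => z /xrU Uz; apply: contrapT => Oz.
by rewrite -[False]/(set0 z) -UO; split.
Qed.

Lemma process_ball_approx :
  exists (n : nat) (r : {posnum R}),
    forall z (e : R), `|z| < r%:num -> 0 < e ->
      exists2 a, domain_below n%:R a & `|z - a| < e.
Proof.
have [n [x [r xr]]] := process_somewhere_dense; exists n, r => z e zr e0.
(* [z] is the half-difference of [x + z] and [x - z], both in the ball at [x]. *)
have approx w : `|w| < r%:num ->
    exists2 a, domain_below n%:R a & `|x + w - a| < e.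
  move=> wr; have /xr/(_ _ (nbhsx_ballx _ e e0)) [a [? ]] : ball x r%:num (x + w).
    by rewrite -ball_normE /= opprD addNKr normrN.
  by rewrite -ball_normE /=; exists a.
have [a [y Ca yn] ae] := approx _ zr.
have [|b [y' Cb yn'] be] := approx (- z); first by rewrite normrN.
(* [C_opp] flips only the first coordinate, so [a - b] is paired with [y + y']; after halving, the
   bound is [n] again. *)
exists (2^-1 *: (a - b)).
  exists (2^-1 *: (y + y')).
    exact: (C_scale 2^-1 _ _ (C_add _ _ Ca (C_opp _ _ Cb))).
  rewrite normrZ ger0_norm ?invr_ge0// ler_pdivrMl//.
  by rewrite (le_trans (ler_normD _ _))// mulr_natl mulr2n lerD.
have -> : z - 2^-1 *: (a - b) = 2^-1 *: ((x + z - a) - (x - z - b)).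
  apply: (scalerI (a := 2)) => //.
  rewrite scalerBr !scalerA mulfV ?pnatr_eq0// !scale1r scaler_nat mulr2n.
  rewrite !opprB [b - a]addrC [b + _]addrC [RHS]addrACA.
  by rewrite [x + z + _]addrC [z - x + _]addrA subrK.
rewrite normrZ ger0_norm ?invr_ge0// ltr_pdivrMl//.
by rewrite (le_lt_trans (ler_normB _ _))// mulr_natl mulr2n ltrD.
Qed.

Lemma process_half_approx :
  exists2 K : R, 0 <= K & forall z, exists p : E * F,
    [/\ C p, `|p.2| <= K * `|z| & `|z - p.1| <= `|z| / 2].
Proof.
have [n [r nr]] := process_ball_approx.
exists (2 * n%:R / r%:num) => // z.
have [->|z0] := eqVneq z 0.
  by exists 0; rewrite subrr !normr0 mulr0 mul0r.
have nz : 0 < `|z| by rewrite normr_gt0.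
(* Scaling by [t] brings [z] to norm [r / 2], inside the ball. Scaling back by [t^-1] turns the
   bound [n] into [2 n / r] times the norm of [z], which explains the constant, and the tolerance
   into half that norm. *)
pose t : R := r%:num / (2 * `|z|).
have t0 : 0 < t by rewrite divr_gt0// mulr_gt0.
have tz : t * `|z| = r%:num / 2 by rewrite /t invfM mulrA divfK ?gt_eqF.
have [||a [y Cay yn] ae] := nr (t *: z) (t * (`|z| / 2)).
- by rewrite normrZ gtr0_norm// tz ltr_pdivrMr// ltr_pMr// ltr1n.
- by rewrite mulr_gt0// divr_gt0.
exists (t^-1 *: (a, y)); split.
- by apply: C_scale => //; rewrite invr_ge0 ltW.
- rewrite normrZ gtr0_norm ?invr_gt0// ler_pdivrMl//.
  rewrite mulrCA tz (le_trans yn)// mulrACA.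
  by rewrite [leRHS](_ : _ = n%:R)//; field; rewrite gt_eqF.
- rewrite /= -[in z - _](scalerK (lt0r_neq0 t0) z) -scalerBr normrZ.
  by rewrite gtr0_norm ?invr_gt0// ler_pdivrMl// ltW.
Qed.

Lemma process_bounded :
  exists2 M : R, 0 <= M & forall x, exists2 y, C (x, y) & `|y| <= M * `|x|.
Proof.
have [K K0 /choice[f fP]] := process_half_approx.
(* The factor 2 is the sum of the powers of 1/2, as the remainders [z n] below at least halve in
   norm at each step. *)
exists (K * 2) => [|x]; first by rewrite mulr_ge0.
pose z n := iter n (fun w => w - (f w).1) x.
pose u n := (f (z n)).2.
have zn n : `|z n| <= geometric `|x| 2^-1 n.
  elim: n => [|n IH] /=; first by rewrite expr0 mulr1.
  have [_ _ /le_trans-> //] := fP (z n).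
  by rewrite exprSr mulrA ler_pM2r.
have un n : `|u n| <= geometric (K * `|x|) 2^-1 n.
  have [_ /le_trans-> //] := fP (z n).
  by rewrite /= -mulrA ler_wpM2l.
(* By telescoping, [x - z n] is the sum of the first [n] approximants, so this pair is a finite sum
   of elements of [C]. *)
have Cs n : C (x - z n, series u n).
  elim: n => [|n IH]; first by rewrite subrr /series /= big_geq.
  have -> : x - z n.+1 = x - z n + (f (z n)).1 by rewrite /= opprB addrA addrAC.
  rewrite seriesSr.
  by have [/(C_add _ _ IH)] := fP (z n); rewrite /u; case: (f (z n)).
have h1 : `|2^-1 : R| < 1 by rewrite ger0_norm// invf_lt1// ltr1n.
have gcv := cvg_geometric_series (a := K * `|x|) h1.
have ncu : cvgn [normed series u].
  by apply: (series_le_cvg _ _ un (cvgP _ gcv)) => // n; exact: le_trans (un n).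
have z0 : z @ \oo --> (0 : E).
  apply/norm_cvg0P; apply: (squeeze_cvgr _ (cvg_cst 0) (cvg_geometric `|x| h1)).
  by apply: nearW => n; rewrite normr_ge0 zn.
exists (limn (series u)).
  have xz : x - z n @[n --> \oo] --> x.
    by rewrite -[X in _ --> X]subr0; apply: cvgB => //; exact: cvg_cst.
  have xsz : (x - z n, series u n) @[n --> \oo] -->
      ((x, limn (series u)) : E * F).
    by apply: cvg_pair => //; exact: normed_cvg.
  exact: closed_cvg C C_closed (nearW _ Cs) _ xsz.
apply: (le_trans (lim_series_norm ncu)).
have -> : K * 2 * `|x| = limn (series (geometric (K * `|x|) 2^-1)).
  by rewrite (cvg_lim _ gcv)// [X in X - _](splitr 1) div1r addrK invrK mulrAC.
apply: ler_lim => //; first exact: cvgP gcv.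
by near=> n; apply: ler_sum => i _; exact: un.
Unshelve. all: by end_near. Qed.

End ClosedConvexProcess.

Theorem theorem4p1 (R : realType) (E : completeNormedModType R)
    (F : banachLatticeType R) (I : Type) (I_nonempty : inhabited I)
    (T : I -> {linear E -> F})
    (T_bounded : forall i : I, exists C : R, forall x : E, `|T i x| <= C * `|x|)
    (orbit_bounded : forall x : E, order_bounded (range (fun i => T i x))) :
  exists2 M : R, 0 <= M &
    forall x : E, exists y : F,
      [/\ 0 <= y, `|y| <= M * `|x| & range (fun i => T i x) `<=` `[- y, y]].
Proof.
(* Stating [- y <= T i x <= y] as two nonnegativity conditions presents [C] as an intersection of
   preimages of the positive cone under continuous maps, hence closed. *)
pose C : set (E * F) := [set p | 0 <= p.2 /\
  forall i, 0 <= p.2 - T i p.1 /\ 0 <= p.2 + T i p.1].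
have Tc i : continuous (T i).
  have [c cP] := T_bounded i.
  apply/linear_bounded_continuous/linear_boundedP.
  exists c; split=> [|r /ltW cr x]; first exact: num_real.
  by rewrite (le_trans (cP x))// ler_wpM2r.
have [|||||M M0 MP] := @process_bounded R E F C.
- move=> [x y] [x' y'] [/= y0 xy] [/= y0' xy']; split=> [|i] /=.
    by rewrite -(addr0 0); exact: vlerD.
  have [? ?] := xy i; have [? ?] := xy' i.
  rewrite linearD; split; rewrite ?opprD addrACA -(addr0 0); exact: vlerD.
- move=> a [x y] a0 [/= y0 xy]; split=> [|i] /=; first exact: vscale_ge0.
  have [? ?] := xy i.
  by rewrite linearZ -scalerBr -scalerDr; split; exact: vscale_ge0.
- move=> x y [/= y0 xy]; split=> [//|i] /=.
  by have [? ?] := xy i; rewrite linearN opprK.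
- have preim (g : E * F -> F) : continuous g -> closed [set p | 0 <= g p].
    move=> gc; apply: (preimage_closed (D := [set v : F | 0 <= v]) (f := g)).
      by move=> p _; exact: gc.
    exact: closed_vge0.
  have Tp i : continuous (fun p : E * F => T i p.1).
    move=> p; apply: continuous_comp; [exact: cvg_fst|exact: Tc].
  rewrite (_ : C = [set p | 0 <= p.2] `&`
      \bigcap_i ([set p | 0 <= p.2 - T i p.1] `&` [set p | 0 <= p.2 + T i p.1])).
    apply: closedI; first by apply: preim => p; exact: cvg_snd.
    apply: closed_bigI => i _; apply: closedI; apply: preim => p.
      by apply: cvgB; [exact: cvg_snd|exact: Tp].
    by apply: cvgD; [exact: cvg_snd|exact: Tp].
  apply/seteqP; split=> p [? h]; split=> // i; first by move=> _; exact: h.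
  exact: (h i Logic.I).
- move=> x; have [a [b ab]] := orbit_bounded x.
  (* From [a <= T i x <= b], [b] dominates [T i x] and [- a] dominates [- T i x]; joining with 0
     puts the witness in the cone. *)
  exists (Order.join (Order.join b (- a)) 0); split=> [|i] /=; first exact: leUr.
  have /ab : range (fun i => T i x) (T i x) by exists i.
  rewrite /= in_itv /= => /andP[aT Tb]; split.
    by rewrite vsubr_ge0 (le_trans Tb)// (le_trans (leUl _ _) (leUl _ _)).
  rewrite -[T i x]opprK vsubr_ge0; apply: (@le_trans _ _ (- a)).
    by rewrite -vsubr_ge0 opprK addrC vsubr_ge0.
  by rewrite (le_trans (leUr _ _) (leUl _ _)).
exists M => // x; have [y [/= y0 xy] yM] := MP x.
exists y; split=> // _ [i _ <-]; have [Ty Ny] := xy i.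
by rewrite /= in_itv /= -vsubr_ge0 opprK addrC Ny -vsubr_ge0 Ty.
Qed.
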